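(* There exist constants $\delta>0$ and $C>0$ such that the following holds for all sufficiently large $n$: for every positive integer $b\leq\delta \sqrt{\frac{n}{\ln^5 n}}$, Maker can win the $(1:b)$ Hamilton Cycle game played on $E(K_n)$ within $n+ C b^2\ln^5 n$ moves.
   Context: A $(1:b)$ Maker-Breaker game on the edge set $E(G)$ of a graph $G$: two players, Maker and Breaker, alternately claim previously unclaimed edges of $G$, with Breaker going first; in each move Breaker claims $b$ unclaimed edges and Maker claims one unclaimed edge. In the Hamilton Cycle game on $E(K_n)$, Maker wins if the graph of his claimed edges contains a Hamilton cycle of $K_n$; Breaker wins otherwise. ''Maker can win within $m$ moves'' means Maker has a strategy guaranteeing that his graph contains a Hamilton cycle after at most $m$ of his own moves, whatever Breaker does. $\ln$ is the natural logarithm. *)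

(* Defs.v *)
From HB Require Import structures.
From mathcomp Require Import all_boot all_order all_algebra.
From mathcomp Require Import reals exp.

Set Implicit Arguments.
Unset Strict Implicit.
Unset Printing Implicit Defensive.

(* Maker-Breaker games with bias (1 : b) on a finite board, Breaker moving
   first.  In round i = 0, 1, 2, ... Breaker claims the set [beta i] and Maker
   answers with one element.  A strategy of Maker is a function of the moves
   made by Breaker so far, including the one being answered; Maker's own
   previous moves are determined by these. *)
Definition maker_strategy (X : finType) : Type := seq {set X} -> X.

Definition maker_move (X : finType) (sigma : maker_strategy X)
    (beta : nat -> {set X}) (i : nat) : X :=
  sigma (mkseq beta i.+1).

Definition maker_claimed (X : finType) (sigma : maker_strategy X)
    (beta : nat -> {set X}) (k : nat) : {set X} :=
  [set maker_move sigma beta i | i : 'I_k].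

Definition breaker_claimed (X : finType) (beta : nat -> {set X}) (k : nat) :
    {set X} :=
  \bigcup_(i < k) beta i.

(* The elements that nobody has claimed during the first k rounds. *)
Definition unclaimed (X : finType) (board : {set X}) (sigma : maker_strategy X)
    (beta : nat -> {set X}) (k : nat) : {set X} :=
  board :\: (maker_claimed sigma beta k :|: breaker_claimed beta k).

(* Breaker claims exactly b elements, or all the remaining ones when fewer
   than b are left. *)
Definition breaker_legal (X : finType) (board : {set X}) (b : nat)
    (sigma : maker_strategy X) (beta : nat -> {set X}) (i : nat) : Prop :=
  beta i \subset unclaimed board sigma beta i /\
  #|beta i| = minn b #|unclaimed board sigma beta i|.

Definition maker_legal (X : finType) (board : {set X})
    (sigma : maker_strategy X) (beta : nat -> {set X}) (i : nat) : Prop :=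
  maker_move sigma beta i \in unclaimed board sigma beta i :\: beta i.

(* Only Maker's moves up to the winning round need to be legal: the board may
   be exhausted afterwards. *)
Definition maker_wins_within (X : finType) (board : {set X}) (b : nat)
    (win : {set X} -> Prop) (m : nat) : Prop :=
  exists sigma : maker_strategy X, forall beta : nat -> {set X},
    (forall i, breaker_legal board b sigma beta i) ->
    exists k, [/\ k <= m,
                  forall i, i < k -> maker_legal board sigma beta i
                & win (maker_claimed sigma beta k)].

Definition complete_edges (V : finType) : {set {set V}} :=
  [set e : {set V} | #|e| == 2].

Definition adjacent (V : finType) (E : {set {set V}}) : rel V :=
  fun x y => [set x; y] \in E.

(* The bound on the size of c excludes a single edge traversed back and
   forth. *)
Definition has_hamilton_cycle (V : finType) (E : {set {set V}}) : Prop :=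
  exists c : seq V,
    [/\ 2 < size c, ucycle (adjacent E) c & forall v : V, v \in c].

Definition maker_wins_hamilton_within (n b m : nat) : Prop :=
  maker_wins_within (complete_edges 'I_n) b (@has_hamilton_cycle 'I_n) m.

(* Main.v *)
(* Maker keeps a cyclic arrangement of all the vertices; a gap is a pair of
   cyclically consecutive vertices that is not yet an edge of Maker.  Initially
   all n pairs are gaps, and an arrangement without gaps is a Hamilton cycle.
   Give a gap xy the weight l^(d x) + l^(d y), where d is the degree in
   Breaker's graph and l = 1 + 1/m with m = 8bt.  If Maker spends t rounds on
   removing a gap with an end of maximal Breaker degree, the growth of the
   weights during these rounds is compensated by the weight of that end, so the
   total weight stays at most 2n and every end has degree O(m ln n).

   While more than r = O(b ln n) gaps are left, t = 1 suffices: the chosen end p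
   has a free edge to the corresponding end of another gap, and reversing the
   part of the cycle in between removes a gap.

   Each of the last r gaps costs t = 2(b + 2) + 1 rounds.  Write the cycle as
   s_0, ..., s_(n-1) with the gap s_(n-1) s_0.  Maker claims b + 2 edges
   s_0 s_i in the first half and b + 2 edges s_(n-1) s_j in the second half;
   any edge s_(i-1) s_(j+1) then closes a new cycle in which the gap is gone.
   These are (b + 2)^2 edges, and if i and j are chosen well, Breaker only owns
   those among them that he claimed in the last b + 3 rounds, at most b(b + 3).
   In total Maker needs n + O(b^2 ln n) moves. *)
Require Import Defs.
From HB Require Import structures.
From mathcomp Require Import all_boot all_order all_algebra.
From mathcomp Require Import boolp reals sequences exp.
From mathcomp Require Import zify ring lra.
Import Order.TTheory GRing.Theory Num.Theory.

Set Implicit Arguments.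
Unset Strict Implicit.
Unset Printing Implicit Defensive.

(** * Forcing a position *)

Section Game.
Context {X : finType}.
Implicit Types (M B S : {set X}) (G : {set X} -> {set X} -> Prop) (e : X).

Definition free_edges (board : {set X}) M B : {set X} := board :\: (M :|: B).

(* Maker, with Breaker to move at the position (M, B), can reach G within j
   rounds; G is tested before Breaker's moves. *)
Fixpoint force (board : {set X}) b G (j : nat) M B : Prop :=
  if j is j'.+1 then
    G M B \/
    forall S, S \subset free_edges board M B ->
      #|S| = minn b #|free_edges board M B| ->
      exists2 e, e \in free_edges board M B :\: S &
                 force board b G j' (e |: M) (B :|: S)
  else G M B.

Context {board : {set X}} {b : nat}.

Lemma force_now G j M B : G M B -> force board b G j M B.
Proof. by case: j => //= j; left. Qed.

Lemma force_leq G i j M B :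
  i <= j -> force board b G i M B -> force board b G j M B.
Proof.
elim: i j M B => [|i IHi] [|j] M B //=; first by left.
rewrite ltnS => le_ij [GMB|moves]; first by left.
by right=> S S1 S2; have [e eP /IHi-/(_ _ le_ij)] := moves S S1 S2; exists e.
Qed.

Lemma force_trans G G' i j M B :
  force board b G i M B ->
  (forall M' B', G M' B' -> force board b G' j M' B') ->
  force board b G' (i + j) M B.
Proof.
move=> GMB GG'; elim: i M B GMB => [|i IHi] M B; first exact: GG'.
case=> [/GG' G'MB|moves]; first exact: force_leq (leq_addl _ _) G'MB.
by rewrite addSn; right=> S S1 S2; have [e eP /IHi] := moves S S1 S2; exists e.
Qed.

Lemma force_impl G G' j M B :
  (forall M' B', G M' B' -> G' M' B') ->
  force board b G j M B -> force board b G' j M B.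
Proof.
by move=> GG' /force_trans-/(_ G' 0); rewrite addn0; apply=> M' B' /GG'.
Qed.

(* If Maker already owns the edge that he wants to claim, antitonicity in
   Breaker's graph shows that the goal held before Breaker's last move. *)
Lemma force1 G M B :
  (forall M' B' B'', B' \subset B'' -> G M' B'' -> G M' B') ->
  (forall S, S \subset free_edges board M B -> #|S| <= b ->
    exists e, [/\ e \in board, e \notin B :|: S & G (e |: M) (B :|: S)]) ->
  force board b G 1 M B.
Proof.
move=> Ganti moves /=; have [|nGMB] := pselect (G M B); first by left.
right=> S S1 S2; have [|e [eb eBS Ge]] := moves S S1.
  by rewrite S2 geq_minl.
exists e => //; have [eM|neM] := boolP (e \in M).
  case: nGMB; apply: Ganti (subsetUl B S) _.
  by rewrite (setUidPr _) ?sub1set in Ge.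
by move: eBS; rewrite !inE eb (negPf neM) /= negb_or => /andP[-> ->].
Qed.

(** A strategy sees only Breaker's moves, so it recomputes the position by replaying them, with
    Maker's answers supplied by a choice function that preserves [force] whenever some answer
    does. *)
Lemma force_maker_wins (win : {set X} -> Prop) m (x0 : X) :
  force board b (fun M _ => win M) m set0 set0 ->
  maker_wins_within board b win m.
Proof.
move=> win_m; pose G M (_ : {set X}) := win M.
(* [D] is the move being answered and [j] the number of rounds left after the answer. Being an
   implication, the specification can be met at every position, so choice yields a total [pick]. *)
pose ok (p : nat * {set X} * {set X} * {set X}) e :=
  let: (j, M, B, D) := p in
  (exists2 e', e' \in free_edges board M B :\: D &
     force board b G j (e' |: M) (B :|: D)) ->
  e \in free_edges board M B :\: D /\ force board b G j (e |: M) (B :|: D).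
have [[[[j M] B] D]|pick pickP] := choice (P := ok).
  have [ex_e|n_ex] := pselect (exists2 e', e' \in free_edges board M B :\: D &
     force board b G j (e' |: M) (B :|: D)).
    by case: (ex_e) => e *; exists e.
  by exists x0.
pose step (st : nat * {set X} * {set X}) S :=
  let: (j, M, B) := st in (j.-1, pick (j.-1, M, B, S) |: M, B :|: S).
pose state h := foldl step (m, set0, set0) h.
pose sigma h := let: (j, M, B) := state (take (size h).-1 h) in
  pick (j.-1, M, B, last set0 h).
exists sigma => beta beta_legal.
have moveE i : maker_move sigma beta i =
    let: (j, M, B) := state (mkseq beta i) in pick (j.-1, M, B, beta i).
  by rewrite /maker_move /sigma size_mkseq mkseqS last_rcons -cats1
             take_size_cat ?size_mkseq.
have stateE i : state (mkseq beta i) =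
    (m - i, maker_claimed sigma beta i, breaker_claimed beta i).
  elim: i => [|i IHi].
    by rewrite subn0 /maker_claimed /breaker_claimed big_ord0 /state /=;
       congr (_, _, _); apply/setP=> e; rewrite inE;
       apply/esym/imsetP=> -[[]].
  rewrite mkseqS /state foldl_rcons -/(state _) IHi /= subnS.
  rewrite /breaker_claimed big_ord_recr /=.
  congr (_, _, _); apply/setP=> e; rewrite in_setU1.
  have := moveE i; rewrite IHi => <-.
  apply/orP/imsetP=> [[/eqP->|/imsetP[k _ ->]]|[k _ ->]].
  - by exists ord_max.
  - by exists (widen_ord (leqnSn i) k).
  - have := ltn_ord k; rewrite ltnS leq_eqVlt => /orP[/eqP ->|lt_ki].
      by left.
    by right; apply/imsetP; exists (Ordinal lt_ki).
(* Induction on the number [j] of rounds left, after [i] rounds played by the strategy. *)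
suff main j i : i + j = m ->
    force board b G j (maker_claimed sigma beta i) (breaker_claimed beta i) ->
    (forall i', i' < i -> maker_legal board sigma beta i') ->
    exists k, [/\ k <= m, forall i', i' < k -> maker_legal board sigma beta i'
                & win (maker_claimed sigma beta k)].
  apply: (main m 0) => //.
  have := stateE 0; rewrite subn0 /state /= => -[<- <-].
  exact: win_m.
elim: j i => [|j IHj] i ijm.
  by move=> /= Gi legal; exists i; split=> //; rewrite -ijm leq_addr.
case=> [Gi|moves] legal; first by exists i; split=> //; rewrite -ijm leq_addr.
have [beta_sub beta_card] := beta_legal i.
have /(pickP (j, _, _, _)) [] := moves _ beta_sub beta_card.
have := moveE i; rewrite stateE.
have -> : (m - i).-1 = j by lia.
move=> <- move_ok forced.
have := stateE i.+1; rewrite mkseqS /state foldl_rcons -/(state _) stateE /=.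
have -> : (m - i).-1 = j by lia.
have := moveE i; rewrite stateE.
have -> : (m - i).-1 = j by lia.
move=> <- [_ claimedM claimedB].
apply: (IHj i.+1); first by lia.
  by rewrite -claimedM -claimedB.
move=> i'; rewrite ltnS leq_eqVlt => /orP[/eqP ->|/legal //].
by [].
Qed.

End Game.

(** * Sums over cyclic sequences *)

Section CyclicSums.
Context {V : eqType} {R : realFieldType}.
Implicit Types (f : V -> V -> R) (s c A B : seq V) (x y : V).
Local Open Scope ring_scope.

(** The last pair is the seam, from the last element back to the first; [ppairs] leaves it out. *)
Definition cpairs s := zip s (rot 1 s).

Definition ppairs s := zip s (behead s).

Definition csum f s : R := \sum_(e <- cpairs s) f e.1 e.2.

Definition psum f s : R := \sum_(e <- ppairs s) f e.1 e.2.

Lemma cpairs_rcons x0 s : s != [::] ->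
  cpairs s = rcons (ppairs s) (last x0 s, head x0 s).
Proof.
case: s => // x s _; rewrite /cpairs /ppairs rot1_cons /=.
case: s => //= y s; congr (_ :: _).
elim: s x y => //= z s IHs x y; congr (_ :: _); exact: IHs.
Qed.

Lemma csumE x0 f s : s != [::] ->
  csum f s = psum f s + f (last x0 s) (head x0 s).
Proof.
by move=> sn0; rewrite /csum (cpairs_rcons x0) // -cats1 big_cat big_seq1.
Qed.

Lemma psum_cat x0 f s1 s2 : s1 != [::] -> s2 != [::] ->
  psum f (s1 ++ s2) = psum f s1 + f (last x0 s1) (head x0 s2) + psum f s2.
Proof.
case: s1 s2 => [|x s1] [|y s2] // _ _.
elim: s1 x => [|z s1 IHs] x.
  by rewrite /psum /ppairs /= big_cons big_nil add0r.
have psum_cons u v s : psum f [:: u, v & s] = f u v + psum f (v :: s).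
  by rewrite /psum /ppairs /= big_cons.
by rewrite !cat_cons psum_cons -cat_cons IHs psum_cons !addrA.
Qed.

Lemma psum_rev f s : (forall x y, f x y = f y x) -> psum f (rev s) = psum f s.
Proof.
move=> fC; elim: s => [|x [|y s] IHs] //.
rewrite -[x :: _]cat1s rev_cat !(psum_cat x) -?size_eq0 ?size_rev // IHs.
rewrite rev_cons last_rcons fC /= addrC [RHS]addrC addrA.
by rewrite [_ + psum f (y :: s)]addrC -!addrA; congr (_ + _); rewrite addrC.
Qed.

Lemma csum_rot f k s : csum f (rot k s) = csum f s.
Proof.
case: s => // x0 s; set c := x0 :: s.
have [kc|ck] := ltnP k (size c); last by rewrite rot_oversize.
have [->|kn0] := eqVneq k 0%N; first by rewrite rot0.
rewrite !(csumE x0) // -?size_eq0 ?size_rot //.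
have tn0 : take k c != [::] by rewrite -size_eq0 size_take_min; lia.
have dn0 : drop k c != [::] by rewrite -size_eq0 size_drop; lia.
rewrite -[c in RHS](cat_take_drop k) /rot !(psum_cat x0) //.
rewrite !last_cat.
have hd u v : u != [::] -> head x0 (u ++ v) = head x0 u by case: u.
have ls u v : u != [::] -> last v u = last x0 u by case: u.
rewrite !hd // (ls (take k c) (last _ _)) // (ls (drop k c) (last _ _)) //.
by ring.
Qed.

Lemma head_rev x0 s : head x0 (rev s) = last x0 s.
Proof. by case/lastP: s => // s x; rewrite rev_rcons last_rcons. Qed.

Lemma last_rev x0 s : last x0 (rev s) = head x0 s.
Proof. by case: s => // x s; rewrite rev_cons last_rcons. Qed.

Lemma csum_rev f s : (forall x y, f x y = f y x) -> csum f (rev s) = csum f s.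
Proof.
move=> fC; case: s => // x0 s; rewrite !(csumE x0) -?size_eq0 ?size_rev //.
by rewrite psum_rev // fC head_rev last_rev.
Qed.

Lemma csum_cat x0 f s1 s2 : s1 != [::] -> s2 != [::] ->
  csum f (s1 ++ s2) = psum f s1 + f (last x0 s1) (head x0 s2) + psum f s2
                      + f (last x0 s2) (head x0 s1).
Proof.
move=> s1n0 s2n0; rewrite (csumE x0) ?(psum_cat x0) //; last by case: s1 s1n0.
by rewrite last_cat; case: s2 s2n0 => //= y s2 _; case: s1 s1n0.
Qed.

Lemma csumD F s :
  csum (fun x y => F x + F y) s = (\sum_(x <- s) F x) *+ 2.
Proof.
rewrite /csum big_split /= mulr2n /cpairs; congr (_ + _).
  rewrite -(big_map fst predT F) -/(unzip1 _) unzip1_zip //.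
  by rewrite size_rot.
rewrite -(big_map snd predT F) -/(unzip2 _) unzip2_zip ?size_rot //.
by apply: perm_big; rewrite perm_rot.
Qed.

(** Together with [csum_rot], this allows any chosen gap to be moved to the seam of the tour. *)
Lemma mem_cpairs_rot x0 x y s : (x, y) \in cpairs s ->
  exists k, last x0 (rot k s) = x /\ head x0 (rot k s) = y.
Proof.
move=> /(nthP (x0, x0))[i]; rewrite size_zip size_rot minnn => lt_is.
rewrite nth_zip ?size_rot // => -[<- <-].
exists i.+1; rewrite rotS //; split.
  have: rot i s != [::] by rewrite -size_eq0 size_rot; lia.
  have: head x0 (rot i s) = nth x0 s i.
    by rewrite /rot (drop_nth x0).
  by case: (rot i s) => //= u v <- _; rewrite rot1_cons last_rcons.
rewrite rot_rot {1}/rot.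
by rewrite (drop_nth x0) ?size_rot.
Qed.

Lemma mem_ppairs_split x0 x y s : (x, y) \in ppairs s ->
  exists s1 s2, [/\ s = s1 ++ s2, s1 != [::], s2 != [::],
                    last x0 s1 = x & head x0 s2 = y].
Proof.
case: s => // z s; elim: s z => // u s IHs z.
rewrite in_cons => /orP[/eqP[-> ->]|/IHs[s1 [s2 [-> n1 n2 e1 e2]]]].
  by exists [:: z], (u :: s).
by exists (z :: s1), s2; split=> //=; case: s1 n1 e1.
Qed.

End CyclicSums.

(** * Degrees and the potential *)

Section Degree.
Context {V : finType}.
Implicit Types (M B S : {set {set V}}) (v : V).

Definition degree B v := #|[set e in B | v \in e]|.

Lemma degreeS B B' v : B \subset B' -> degree B v <= degree B' v.
Proof.
move=> sub; apply: subset_leq_card; apply/subsetP=> e.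
by rewrite !inE => /andP[/(subsetP sub) -> ->].
Qed.

Lemma degreeU B S v : degree (B :|: S) v <= degree B v + degree S v.
Proof.
rewrite /degree (leq_trans _ (leq_card_setU _ _)) // subset_leq_card //.
by apply/subsetP=> e; rewrite !inE => /andP[/orP[]-> ->]; rewrite ?orbT.
Qed.

Lemma degree_card B v : degree B v <= #|B|.
Proof.
by apply: subset_leq_card; apply/subsetP=> e; rewrite inE => /andP[].
Qed.

Lemma degreeD B0 B v : degree B v <= degree B0 v + degree (B :\: B0) v.
Proof.
apply: leq_trans (degreeU _ _ _); apply: degreeS.
by apply/subsetP=> e eB; rewrite !inE eB andbT orbN.
Qed.

(** Handshake lemma: double counting of incidences, every edge of the board having two ends. *)
Lemma sum_degree B : B \subset complete_edges V ->
  \sum_v degree B v = #|B| * 2.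
Proof.
move=> /subsetP B2; rewrite /degree.
under eq_bigr => v _ do rewrite -sum1_card.
rewrite (exchange_big_dep (mem B)) /=; last first.
  by move=> v e _; rewrite inE => /andP[].
rewrite -sum_nat_const; apply: eq_bigr => e eB.
have := B2 e eB; rewrite inE => /eqP <-; rewrite -sum1_card.
by apply: eq_bigl => v; rewrite inE eB.
Qed.

(** Markov's inequality for the degree sum. *)
Lemma card_degree_gt B d : B \subset complete_edges V ->
  #|[set v | d < degree B v]| * d <= #|B| * 2.
Proof.
move=> /sum_degree <-; rewrite -sum_nat_const.
rewrite [leqRHS](bigID (mem [set v | d < degree B v])) /=.
by apply: leq_trans (leq_addr _ _); apply: leq_sum => v; rewrite inE => /ltnW.
Qed.

End Degree.

(** * The exponential potential and its growth *)

Section Potential.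
Context (R : realFieldType) {V : finType}.
Implicit Types (M B S : {set {set V}}) (v x y : V) (c : seq V) (m : nat).
Local Open Scope ring_scope.

(** In the applications [m] is eight times the bound on the number of edges that Breaker claims
    while one gap is removed. *)
Definition base m : R := 1 + m%:R^-1.

Lemma base_ge1 m : 1 <= base m.
Proof. by rewrite lerDl invr_ge0. Qed.

Lemma base_gt0 m : 0 < base m.
Proof. exact: lt_le_trans (base_ge1 m). Qed.

Lemma base_pow_mono m :
  {homo (fun d => base m ^+ d) : i j / (i <= j)%N >-> i <= j}.
Proof. by move=> i j le_ij; rewrite ler_weXn2l // base_ge1. Qed.

Lemma base_anti m m' : (0 < m)%N -> (m <= m')%N -> base m' <= base m.
Proof.
by move=> m0 le_m; rewrite lerD2l lef_pV2 ?ler_nat // posrE ltr0n //; lia.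
Qed.

(** By induction on [t]: the quadratic term 2t/m^2 of the next product is at most 1/m because 2t <=
    m. *)
Lemma base_pow_le m t : (t * 2 <= m)%N -> base m ^+ t <= 1 + t%:R * 2 / m%:R.
Proof.
case: m => [|m]; first by case: t => // _; rewrite expr0 !mul0r addr0.
elim: t => [|t IHt] tm; first by rewrite expr0 !mul0r addr0.
rewrite exprS; have {}IHt := IHt ltac:(lia).
have t2m : (t%:R * 2 : R) <= m.+1%:R by rewrite -natrM ler_nat; lia.
rewrite /base; set z : R := m.+1%:R^-1.
have z0 : 0 < z by rewrite invr_gt0 ltr0n.
have tz : t%:R * 2 * z <= 1 by rewrite ler_pdivrMr ?mul1r // ltr0n.
have step : (1 + z) * base m.+1 ^+ t <= (1 + z) * (1 + t%:R * 2 * z).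
  by rewrite ler_pM2l //; lra.
apply: le_trans step _; rewrite -/z -[t.+1]addn1 natrD.
have := ler_wpM2r (ltW z0) tz; lra.
Qed.

(** Bernoulli's inequality at exponent [m]. *)
Lemma base_pow_ge2 m : (0 < m)%N -> 2 <= base m ^+ m.
Proof.
move=> m0; have bern t : 1 + t%:R / m%:R <= base m ^+ t.
  elim: t => [|t IHt]; first by rewrite mul0r addr0 expr0.
  rewrite exprS mulrDl mul1r -[t.+1]addn1 natrD mulrDl mul1r addrA.
  rewrite lerD // ler_peMr ?invr_ge0 //.
  by rewrite -[leLHS](expr0 (base m)) base_pow_mono.
by have := bern m; rewrite divff ?pnatr_eq0; [lra | lia].
Qed.

Definition is_gap M x y : R := ([set x; y] \notin M)%:R.

Definition gap_weight m M B x y : R :=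
  is_gap M x y * (base m ^+ degree B x + base m ^+ degree B y).

Definition potential m M B c : R := csum (gap_weight m M B) c.

Lemma is_gapC M x y : is_gap M x y = is_gap M y x.
Proof. by rewrite /is_gap setUC. Qed.

Lemma gap_weightC m M B x y : gap_weight m M B x y = gap_weight m M B y x.
Proof. by rewrite /gap_weight is_gapC addrC. Qed.

Lemma is_gap_ge0 M x y : 0 <= is_gap M x y. Proof. exact: ler0n. Qed.

Lemma gap_weight_ge0 m M B x y : 0 <= gap_weight m M B x y.
Proof.
by rewrite mulr_ge0 ?ler0n // addr_ge0 // exprn_ge0 // ltW ?base_gt0.
Qed.

Lemma is_gapS M M' x y : M \subset M' -> is_gap M' x y <= is_gap M x y.
Proof.
move=> /subsetP sub; rewrite /is_gap ler_nat.
by have [/sub ->|_] := boolP ([set x; y] \in M); last exact: leq_b1.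
Qed.

Lemma gap_weightS m M M' B B' x y : M \subset M' -> B' \subset B ->
  gap_weight m M' B' x y <= gap_weight m M B x y.
Proof.
move=> subM subB; rewrite ler_pM ?is_gapS //.
  by rewrite addr_ge0 // exprn_ge0 // ltW ?base_gt0.
by rewrite lerD // base_pow_mono // degreeS.
Qed.

Lemma gap_weight_anti m m' M B x y : (0 < m)%N -> (m <= m')%N ->
  gap_weight m' M B x y <= gap_weight m M B x y.
Proof.
move=> m0 le_m; rewrite ler_wpM2l ?ler0n // lerD // lerXn2r //;
  by rewrite ?base_anti // nnegrE ltW // base_gt0.
Qed.

Lemma le_csum (f g : V -> V -> R) c :
  (forall x y, (x, y) \in cpairs c -> f x y <= g x y) -> csum f c <= csum g c.
Proof.
move=> fg; rewrite /csum big_seq [leRHS]big_seq.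
by apply: ler_sum => -[x y] /=; apply: fg.
Qed.

Lemma le_psum (f g : V -> V -> R) c :
  (forall x y, f x y <= g x y) -> psum f c <= psum g c.
Proof. by move=> fg; apply: ler_sum => e _; apply: fg. Qed.

Lemma csum_ge (f : V -> V -> R) c x y : (forall x y, 0 <= f x y) ->
  (x, y) \in cpairs c -> f x y <= csum f c.
Proof.
move=> f0 xyc; rewrite /csum (big_rem _ xyc) /= lerDl.
by apply: sumr_ge0 => e _.
Qed.

(** Let W be the weight of [v], the largest weight of a gap end. Each new edge at a gap end adds at
    most 2W/m to the weight of that end. A vertex lies in two cyclic pairs and the new degrees sum
    to at most 2k, so the total growth is at most 8kW/m <= W. *)
Lemma potential_growth m M B0 B c v k : (0 < m)%N -> uniq c ->
  B \subset complete_edges V -> (#|B :\: B0| <= k)%N -> (k * 8 <= m)%N ->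
  (forall x y, (x, y) \in cpairs c -> [set x; y] \notin M ->
     (degree B0 x <= degree B0 v)%N /\ (degree B0 y <= degree B0 v)%N) ->
  potential m M B c <= potential m M B0 c + base m ^+ degree B0 v.
Proof.
move=> m0 uc Bb Bk km vmax; set W := base m ^+ degree B0 v.
pose inc x : R := (degree (B :\: B0) x)%:R.
have W0 : 0 < W by rewrite exprn_gt0 ?base_gt0.
have incP x : (degree B0 x <= degree B0 v)%N ->
    base m ^+ degree B x <= base m ^+ degree B0 x + W * 2 / m%:R * inc x.
  move=> xv; apply: le_trans (base_pow_mono m (degreeD B0 B x)) _.
  have dk := leq_trans (degree_card (B :\: B0) x) Bk.
  rewrite exprD.
  apply: le_trans (_ : base m ^+ degree B0 x * (1 + inc x * 2 / m%:R) <= _).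
    by rewrite ler_pM2l ?exprn_gt0 ?base_gt0 // base_pow_le //; lia.
  rewrite mulrDr mulr1 lerD2l.
  have := base_pow_mono m xv; rewrite -/W => xW.
  have -> : W * 2 / m%:R * inc x = W * (inc x * 2 / m%:R) by ring.
  by rewrite ler_wpM2r // !mulr_ge0 ?ler0n ?invr_ge0.
apply: le_trans (_ : csum (fun x y => gap_weight m M B0 x y +
    W * 2 / m%:R * (inc x + inc y)) c <= _).
  apply: le_csum => x y xyc; rewrite /gap_weight /is_gap.
  have [xyM|xyM] := boolP (_ \in M).
    by rewrite !mul0r add0r !mulr_ge0 ?addr_ge0 ?invr_ge0 ?ler0n ?(ltW W0).
  have [/incP xP /incP yP] := vmax _ _ xyc xyM.
  by rewrite !mul1r mulrDr addrACA lerD.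
rewrite /csum big_split /= -/(csum _ c) lerD2l -mulr_sumr.
have -> : \sum_(e <- cpairs c) (inc e.1 + inc e.2) = (\sum_(x <- c) inc x) *+ 2.
  by rewrite -csumD.
have : \sum_(x <- c) inc x <= (k * 2)%:R.
  rewrite big_uniq //=.
  apply: le_trans (_ : (\sum_x degree (B :\: B0) x)%:R <= _).
    rewrite natr_sum [leRHS](bigID (mem c)) /= lerDl.
    by apply: sumr_ge0 => x _; rewrite ler0n.
  rewrite ler_nat sum_degree ?leq_mul2r //.
  by apply: subset_trans Bb; apply: subsetDl.
move=> sum_inc.
have km' : (k * 8)%:R <= m%:R :> R by rewrite ler_nat.
have m0' : 0 < m%:R :> R by rewrite ltr0n.
have -> : W * 2 / m%:R * ((\sum_(x <- c) inc x) *+ 2) =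
    W * ((\sum_(x <- c) inc x) * 4 / m%:R) by ring.
rewrite ger_pMr // ler_pdivrMr // mul1r; apply: le_trans km'.
move: sum_inc; rewrite !natrM; lra.
Qed.

(** A gap end of degree at least m(L+1) would alone weigh at least 2^(L+1), as l^m >= 2, and this
    exceeds 2|V|. *)
Lemma degree_bound m M B c L x y : (0 < m)%N ->
  (#|V| < 2 ^ L)%N -> potential m M B c <= (#|V| * 2)%:R ->
  (x, y) \in cpairs c -> [set x; y] \notin M ->
  (degree B x < m * L.+1)%N /\ (degree B y < m * L.+1)%N.
Proof.
move=> m0 VL phi_le xyc xyM.
have := le_trans (csum_ge (gap_weight_ge0 m M B) xyc) phi_le.
rewrite /gap_weight /is_gap xyM mul1r => sum_le.
have main v : base m ^+ degree B v <= (#|V| * 2)%:R ->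
    (degree B v < m * L.+1)%N.
  move=> v_le; rewrite ltnNge.
  apply/negP=> /(base_pow_mono m) /le_trans/(_ v_le).
  rewrite exprM leNgt => /negP; apply.
  apply: lt_le_trans (_ : 2 ^+ L.+1 <= _).
    by rewrite -natrX ltr_nat expnSr ltn_pmul2r.
  by rewrite lerXn2r ?nnegrE ?exprn_ge0 ?(ltW (base_gt0 m)) // base_pow_ge2.
have ge0 v : 0 <= base m ^+ degree B v by rewrite exprn_ge0 // ltW // base_gt0.
by split; apply: main; apply: le_trans sum_le; rewrite ?lerDl ?lerDr.
Qed.

(** Normal form of the tour: a gap lies at the seam, and its end of maximal Breaker degree among all
    gap ends comes last. Rotations and reversals reach it without changing any symmetric cyclic
    sum. *)
Lemma gap_rotation m M B0 c v0 : (0 < m)%N -> uniq c -> 0 < csum (is_gap M) c ->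
  exists c', [/\ perm_eq c' c, forall f : V -> V -> R,
       (forall x y, f x y = f y x) -> csum f c' = csum f c,
     [set last v0 c'; head v0 c'] \notin M &
     forall B k, B \subset complete_edges V -> (#|B :\: B0| <= k)%N ->
       (k * 8 <= m)%N ->
       potential m M B c' <=
         potential m M B0 c' + base m ^+ degree B0 (last v0 c')].
Proof.
move=> m0 uc gap0.
(* The ends of gaps, over which the degree is maximized. *)
pose E := [pred v | has (fun e => ([set e.1; e.2] \notin M) &&
                           ((v == e.1) || (v == e.2))) (cpairs c)].
have [w wE] : exists w, w \in E.
  apply/existsP; apply: contraLR gap0 => /existsPn noE.
  rewrite -leNgt /csum big1_seq // => -[x y] /= xyc; rewrite /is_gap.
  case: (boolP (_ \in M)) => // xyM; case/negP: (noE x).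
  by apply/hasP; exists (x, y); rewrite //= xyM eqxx.
have [v /hasP[[x y] xyc /= /andP[xyM v_xy]] vmax] :=
  arg_maxnP (degree B0) wE.
have growth B k c' : (forall f : V -> V -> R,
       (forall x y, f x y = f y x) -> csum f c' = csum f c) ->
    B \subset complete_edges V -> (#|B :\: B0| <= k)%N -> (k * 8 <= m)%N ->
    potential m M B c' <= potential m M B0 c' + base m ^+ degree B0 v.
  move=> c'c Bb Bk km; rewrite /potential !c'c; try exact: gap_weightC.
  apply: potential_growth Bb Bk km _ => // x' y' xyc' xyM'.
  by split; apply: vmax; apply/hasP; exists (x', y');
     rewrite //= xyM' eqxx ?orbT.
have [k [lst hd]] := mem_cpairs_rot v0 xyc.
case/orP: v_xy => /eqP vE.
  exists (rot k c); split.
  - by rewrite perm_rot.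
  - by move=> f fC; rewrite csum_rot.
  - by rewrite lst hd.
  - move=> B k' Bb Bk km; rewrite lst -vE; apply: growth Bk km => // f fC.
    by rewrite csum_rot.
(* Here the maximal end is the second vertex of the gap; reversal brings it to the last place. *)
exists (rev (rot k c)); split.
- by rewrite perm_rev perm_rot.
- by move=> f fC; rewrite csum_rev // csum_rot.
- by rewrite last_rev head_rev lst hd setUC.
- move=> B k' Bb Bk km; rewrite last_rev hd -vE; apply: growth Bk km => // f fC.
  by rewrite csum_rev // csum_rot.
Qed.

End Potential.

(** * Removing a gap in one move *)

Section Phase1.
Context (R : realFieldType) {V : finType}.
Implicit Types (M B S : {set {set V}}) (v x y : V) (c : seq V) (m : nat).
Local Open Scope ring_scope.
Local Notation board := (complete_edges V).

Lemma set2_inj x y y' : [set x; y] = [set x; y'] -> y = y'.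
Proof.
move=> eq_xy; have := set22 x y; rewrite eq_xy !inE => /orP[/eqP yx|/eqP//].
by have := set22 x y'; rewrite -eq_xy yx !inE orbb => /eqP ->.
Qed.

Lemma degree_ge B v c : uniq c -> (forall x, x \in c -> [set v; x] \in B) ->
  (size c <= degree B v)%N.
Proof.
move=> uc cB; rewrite -(size_map (fun x => [set v; x])) /degree cardE.
apply: uniq_leq_size.
  by rewrite map_inj_uniq // => x y; apply: set2_inj.
by move=> _ /mapP[x xc ->]; rewrite mem_enum inE cB //= !inE eqxx.
Qed.

Lemma set2_board x y : ([set x; y] \in board) = (x != y).
Proof. by rewrite inE cards2; case: (x != y). Qed.

(** The invariant between removals of gaps: [g] bounds the gaps left, [N] the edges of Breaker, and
    the potential is at most its initial value. *)
Definition state m (g N : nat) M B := exists c : seq V,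
  [/\ perm_eq c (enum V), csum (is_gap R M) c <= g%:R,
      potential R m M B c <= (#|V| * 2)%:R, B \subset board & (#|B| <= N)%N].

Lemma state_anti m g N M B B' :
  B \subset B' -> state m g N M B' -> state m g N M B.
Proof.
move=> sub [c [c1 c2 c3 c4 c5]]; exists c; split=> //.
- apply: le_trans c3; apply: le_csum => x y _; exact: gap_weightS.
- exact: subset_trans c4.
- exact: leq_trans (subset_leq_card sub) c5.
Qed.

Lemma perm_enum_uniq c : perm_eq c (enum V) -> uniq c.
Proof. by move=> /perm_uniq ->; apply: enum_uniq. Qed.

Lemma csum_gapE M c : csum (is_gap R M) c =
  (count (fun e => [set e.1; e.2] \notin M) (cpairs c))%:R.
Proof.
rewrite /csum /is_gap -sum1_count natr_sum [RHS]big_mkcond.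
by apply: eq_bigr => e _; case: ifP.
Qed.

(** The last vertex p has degree below m(L+1) in [B] and gains at most [b] from [S]. At least [g]
    gaps besides the seam remain, and their first ends are distinct, so one of them is not joined to
    p by Breaker. *)
Lemma two_opt m M B S c v0 b L g : (0 < m)%N -> uniq c ->
  [set last v0 c; head v0 c] \notin M ->
  (g < count (fun e => [set e.1; e.2] \notin M) (cpairs c))%N ->
  potential R m M B c <= (#|V| * 2)%:R ->
  (#|V| < 2 ^ L)%N -> (#|S| <= b)%N -> (m * L.+1 + b <= g)%N ->
  exists s1 s2, [/\ c = s1 ++ s2, s1 != [::], s2 != [::],
     [set last v0 s1; head v0 s2] \notin M &
     [set last v0 c; last v0 s1] \notin B :|: S].
Proof.
move=> m0 uc gap_pq count_gap pot VL Sb gE.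
have cn0 : c != [::] by case: c count_gap {uc gap_pq pot} => //.
set p := last v0 c; have cE := cpairs_rcons v0 cn0.
have pq_c : (p, head v0 c) \in cpairs c by rewrite cE mem_rcons mem_head.
have [dp _] := degree_bound m0 VL pot pq_c gap_pq.
(* Path pairs are used in order to leave out the gap at the seam itself. *)
pose cand := [seq e.1 | e <- ppairs c & [set e.1; e.2] \notin M].
have ucand : uniq cand.
  apply: (@subseq_uniq _ _ (unzip1 (ppairs c))).
    by apply: map_subseq; apply: filter_subseq.
  have: subseq (unzip1 (ppairs c)) c.
    rewrite /ppairs; elim: (c) => // x [|y s] IHs //=.
    by rewrite eqxx; apply: IHs.
  by move=> /subseq_uniq; apply.
have: (g <= size cand)%N.
  move: count_gap; rewrite cE -cats1 count_cat /= gap_pq addn0 addn1 ltnS.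
  by rewrite size_map size_filter.
have [all_B|] := pselect (forall x, x \in cand -> [set p; x] \in B :|: S).
  have := degree_ge ucand all_B; have := degreeU B S p.
  by have := degree_card S p; lia.
move=> /existsNP[x] /not_implyP[/mapP[[x' y]]]; rewrite mem_filter /=.
move=> /andP[gap_xy xy_c] -> /negP free_e _.
have [s1 [s2 [cs n1 n2 e1 e2]]] := mem_ppairs_split v0 xy_c.
by exists s1, s2; split=> //; rewrite e1 ?e2.
Qed.

(** The growth [wp'] is paid for by the weight [wp] of p in the removed gap pq; the possible new gap
    qy inherits the weights [wq] and [wy], and [wx] is dropped. *)
Lemma two_opt_arith (P1 P1' P2 P2' wqy wx wy wp wp' wq t : R) :
  P1 + (wx + wy) + P2 + (wp + wq) <= t + wp' -> P1' <= P1 -> P2' <= P2 ->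
  0 < wx -> wqy <= wq + wy -> wp' <= wp -> P1' + wqy + P2' + 0 <= t.
Proof. lra. Qed.

Lemma phase1_step b L g N M B : (0 < b)%N -> (#|V| < 2 ^ L)%N ->
  (8 * b * L.+2 <= g)%N ->
  state (8 * b) g.+1 N M B -> force board b (state (8 * b) g (N + b)) 1 M B.
Proof.
move=> b0 VL gE; set m := (8 * b)%N => -[c [c_perm c_gaps c_pot Bb BN]].
have m0 : (0 < m)%N by rewrite /m; lia.
have [few|many] := leP (csum (is_gap R M) c) g%:R.
  by apply: force_now; exists c; split=> //; apply: leq_trans (leq_addr _ _).
have [v0 _] : exists v0 : V, v0 \in c.
  move: many; case: (c) => [|v s _]; last by exists v; rewrite mem_head.
  by rewrite /csum big_nil ltNge ler0n.
have gap0 : 0 < csum (is_gap R M) c by apply: le_lt_trans many.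
have [c' [c'_perm c'_sum gap_pq growth]] :=
  gap_rotation B v0 m0 (perm_enum_uniq c_perm) gap0.
have c'_gaps : csum (is_gap R M) c' = csum (is_gap R M) c.
  by apply: c'_sum; apply: is_gapC.
have c'_pot : potential R m M B c' = potential R m M B c.
  by apply: c'_sum; apply: gap_weightC.
have {}c'_perm := perm_trans c'_perm c_perm.
have uc' := perm_enum_uniq c'_perm.
apply: force1 => [M' B' B''|S S1 Sb]; first exact: state_anti.
have SV : S \subset board by apply: subset_trans S1 (subsetDl _ _).
have [|||s1 [s2 [c's n1 n2 gap_xy free_e]]] :=
  two_opt (m := m) (B := B) (b := b) (L := L) (g := g)
    m0 uc' gap_pq _ _ VL Sb _.
- by rewrite -(ltr_nat R) -csum_gapE c'_gaps.
- by rewrite c'_pot.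
- by apply: leq_trans gE; rewrite [leqRHS]mulnS addnC leq_add2r leq_pmull.
set p := last v0 c' in gap_pq growth free_e.
set q := head v0 c' in gap_pq.
set x := last v0 s1 in gap_xy free_e; set y := head v0 s2 in gap_xy.
have pE : p = last v0 s2.
  by rewrite /p c's last_cat; case: (s2) n2.
have qE : q = head v0 s1 by rewrite /q c's; case: (s1) n1.
have px : p != x.
  have: x \in s1 by rewrite /x; case: (s1) n1 => //= ? ? _; apply: mem_last.
  have: p \in s2 by rewrite pE; case: (s2) n2 => //= ? ? _; apply: mem_last.
  move: uc'; rewrite c's cat_uniq => /and3P[_ /hasPn dis _] /dis ps1 xs1.
  by apply: contraNneq ps1 => ->.
set e := [set p; x] in free_e *.
exists e; split=> //; first by rewrite set2_board.
have eM : M \subset e |: M by apply: subsetUr.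
have rn1 : rev s1 != [::] by rewrite -size_eq0 size_rev size_eq0.
have new_sum f : (forall x y, f x y = f y x) -> csum f (rev s1 ++ s2) =
    psum f s1 + f q y + psum f s2 + f p x :> R.
  by move=> fC; rewrite (csum_cat v0) // psum_rev // last_rev head_rev -qE -pE.
have old_sum f : csum f c' = psum f s1 + f x y + psum f s2 + f p q :> R.
  by rewrite c's (csum_cat v0) // -pE -qE.
have gap_px B' : gap_weight R m (e |: M) B' p x = 0.
  by rewrite /gap_weight /is_gap setU11 mul0r.
(* Reversing [s1] replaces the gaps xy and pq by the pair qy and Maker's new edge px, so at most one
   gap is created while two disappear. *)
exists (rev s1 ++ s2); split.
- by apply: perm_trans c'_perm; rewrite c's perm_cat2r perm_rev.
- rewrite new_sum; last exact: is_gapC.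
  move: c_gaps; rewrite -c'_gaps old_sum.
  have -> : is_gap R M x y = 1 by rewrite /is_gap gap_xy.
  have -> : is_gap R M p q = 1 by rewrite /is_gap gap_pq.
  have -> : is_gap R (e |: M) p x = 0 by rewrite /is_gap setU11.
  have qy1 : is_gap R (e |: M) q y <= 1 by rewrite lern1 leq_b1.
  have p1 : psum (is_gap R (e |: M)) s1 <= psum (is_gap R M) s1.
    by apply: le_psum => u v; apply: is_gapS.
  have p2 : psum (is_gap R (e |: M)) s2 <= psum (is_gap R M) s2.
    by apply: le_psum => u v; apply: is_gapS.
  rewrite -[g.+1]addn1 natrD; lra.
- rewrite /potential new_sum; last exact: gap_weightC.
  have BSb : B :|: S \subset board by rewrite subUset Bb.
  have dS : (#|(B :|: S) :\: B| <= b)%N.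
    apply: leq_trans Sb; apply: subset_leq_card; apply/subsetP=> u.
    by rewrite !inE => /andP[/negPf -> ].
  have bm : (b * 8 <= m)%N by rewrite /m mulnC.
  (* The growth is measured on the old tour with Breaker's new edges; only then is the tour
     changed. *)
  have := growth _ _ BSb dS bm; rewrite /potential in c_pot c'_pot *.
  rewrite c'_pot old_sum gap_px => growth'.
  have p1 : psum (gap_weight R m (e |: M) (B :|: S)) s1 <=
      psum (gap_weight R m M (B :|: S)) s1.
    by apply: le_psum => u v; apply: gap_weightS.
  have p2 : psum (gap_weight R m (e |: M) (B :|: S)) s2 <=
      psum (gap_weight R m M (B :|: S)) s2.
    by apply: le_psum => u v; apply: gap_weightS.
  have pow0 v : 0 < base R m ^+ degree (B :|: S) v.
    by rewrite exprn_gt0 ?base_gt0.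
  have xyE : gap_weight R m M (B :|: S) x y =
      base R m ^+ degree (B :|: S) x + base R m ^+ degree (B :|: S) y.
    by rewrite /gap_weight /is_gap gap_xy mul1r.
  have pqE : gap_weight R m M (B :|: S) p q =
      base R m ^+ degree (B :|: S) p + base R m ^+ degree (B :|: S) q.
    by rewrite /gap_weight /is_gap gap_pq mul1r.
  have qyE : gap_weight R m (e |: M) (B :|: S) q y <=
      base R m ^+ degree (B :|: S) q + base R m ^+ degree (B :|: S) y.
    rewrite /gap_weight ger_pMl; last by rewrite addr_gt0.
    by rewrite lern1 leq_b1.
  have dp : base R m ^+ degree B p <= base R m ^+ degree (B :|: S) p.
    by apply: base_pow_mono; apply: degreeS; apply: subsetUl.
  apply: le_trans c_pot; rewrite xyE pqE in growth'.
  exact: two_opt_arith growth' p1 p2 (pow0 x) qyE dp.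
- by rewrite subUset Bb.
- by apply: leq_trans (leq_card_setU _ _) _; rewrite leq_add.
Qed.

End Phase1.

(** * Rotating both ends of a gap *)

Lemma pigeonhole3 (T : eqType) (a1 a2 a3 : pred T) (s : seq T) :
  count a1 s + count a2 s + count a3 s < size s ->
  exists x, [/\ x \in s, ~~ a1 x, ~~ a2 x & ~~ a3 x].
Proof.
elim: s => //= x s IHs lt_s.
case: (boolP (a1 x)) (boolP (a2 x)) (boolP (a3 x)) lt_s
    => [] a1x [] a2x [] a3x lt_s;
  try by have [|y [ys *]] := IHs;
    [move: lt_s => /=; lia | exists y; rewrite inE ys orbT].
by exists x; rewrite mem_head.
Qed.

Lemma count_has (T U : Type) (r : T -> U -> bool) (s : seq T) (t : seq U) :
  count (fun y => has (fun x => r x y) s) t <= \sum_(x <- s) count (r x) t.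
Proof.
elim: s => [|x s IHs] /=; first by rewrite big_nil count_pred0.
rewrite big_cons; apply: leq_trans (leq_add (leqnn _) IHs).
by rewrite -count_predUI leq_addr.
Qed.

Lemma count_mem_size (T : eqType) (A s : seq T) :
  uniq s -> count (mem A) s <= size A.
Proof.
move=> us; rewrite -size_filter; apply: uniq_leq_size.
  exact: filter_uniq.
by move=> x; rewrite mem_filter => /andP[].
Qed.

Lemma mem_iota_head n i : (i \in iota 1 n./2.-1) = (0 < i < n./2).
Proof. by rewrite mem_iota; lia. Qed.

Lemma mem_iota_tail n i : (i \in iota n./2 (n.-1 - n./2)) = (n./2 <= i < n.-1).
Proof. by rewrite mem_iota; lia. Qed.

Lemma head_pred_lt n i : 0 < i < n./2 -> i.-1 < n. Proof. lia. Qed.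

Lemma head_lt n i : 0 < i < n./2 -> i < n. Proof. lia. Qed.

Lemma tail_succ_lt n i : n./2 <= i < n.-1 -> i.+1 < n. Proof. lia. Qed.

Lemma tail_lt n i : n./2 <= i < n.-1 -> i < n. Proof. lia. Qed.

(** Room for a further position in the first half: [x] counts the positions already used, [y] those
    blocked by Breaker's edges at q, and [z] those whose predecessor has too large a degree. *)
Lemma head_room n k d w a x y z :
  10 * (k + d + w + 5) <= 3 * n -> a < k -> x <= a -> y <= d -> z * 10 <= n ->
  x + y + z < n./2.-1.
Proof. lia. Qed.

Lemma tail_room n k d w a x y z :
  10 * (k + d + w + 5) <= 3 * n -> a < k -> x <= a -> y <= d -> z <= w ->
  x + y + z < n.-1 - n./2.
Proof. lia. Qed.

(** A round adds at most 2b to the old degrees and a new predecessor contributes at most 40b, hence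
    the 42b per position. *)
Lemma head_degree b a x y z :
  y <= z + 2 * b -> z <= 42 * b * a + 2 * b * 0 -> x <= 40 * b ->
  x + y <= 42 * b * a.+1 + 2 * b * 0.
Proof. lia. Qed.

Lemma tail_degree b k a : a < k -> 42 * b * k + 2 * b * a.+1 <= 44 * b * k.
Proof. nia. Qed.

Section Phase2.
Context {V : finType}.
Implicit Types (M B S : {set {set V}}) (v x y : V) (c : seq V) (m : nat).
Local Notation board := (complete_edges V).

Lemma sum_degree_seq S c : uniq c -> S \subset board ->
  \sum_(v <- c) degree S v <= #|S| * 2.
Proof.
move=> uc Sb; rewrite -sum_degree // big_uniq //=.
by rewrite [leqRHS](bigID (mem c)) leq_addr.
Qed.

Lemma count_degree B v (f : nat -> V) (t : seq nat) : uniq (map f t) ->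
  count (fun i => [set v; f i] \in B) t <= degree B v.
Proof.
move=> uf; rewrite -size_filter -(size_map f); apply: degree_ge.
  exact: subseq_uniq (map_subseq _ (filter_subseq _ _)) uf.
by move=> x /mapP[i]; rewrite mem_filter => /andP[iB _] ->.
Qed.

(* (M, B) is the position at the start of the rotations of the gap between
   p and q, and d bounds their Breaker degrees during these 2k + 1 rounds. *)
Context (v0 : V) (c : seq V) (M B : {set {set V}}) (b k d : nat).
Local Notation n := (size c).
Local Notation h := (size c)./2.
Local Notation s i := (nth v0 c i).
Local Notation p := (last v0 c).
Local Notation q := (head v0 c).
Context (uc : uniq c) (b0 : 0 < b) (Bboard : B \subset board).
Context (dp : degree B p + b * (2 * k).+1 <= d).
Context (dq : degree B q + b * (2 * k).+1 <= d).
Context (B_card : #|B| + b * (2 * k).+1 <= 2 * b * n).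
Context (n_large : 10 * (k + d + 44 * b * k + 5) <= 3 * n).

Definition chords (A A' : seq nat) : seq {set V} :=
  [seq [set s i.-1; s j.+1] | i <- A, j <- A'].

(* A and A' are the positions i and j with the new edges q s_i and p s_j.  The
   vertices s_(i-1) have Breaker degree at most 40b when they are chosen, since
   at most n/10 vertices exceed this bound, and Breaker adds at most 2b to the
   sum of these degrees in every round. *)
Definition rotating (a a' : nat) M' B' := exists A A' : seq nat,
  [/\ [/\ M \subset M', B' \subset board & #|B' :\: B| <= b * (a + a')],
  [/\ uniq A, size A = a,
      (forall i, i \in A -> (0 < i < h) && ([set q; s i] \in M')) &
      \sum_(i <- A) degree B' (s i.-1) <= 42 * b * a + 2 * b * a'] &
  [/\ uniq A', size A' = a',
      (forall j, j \in A' -> (h <= j < n.-1) && ([set p; s j] \in M')) &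
      count (mem B') (chords A A') <= b * a']].

Lemma vertex_inj i j : i < n -> j < n -> s i = s j -> i = j.
Proof. by move=> lt_i lt_j /eqP; rewrite nth_uniq // => /eqP. Qed.

(** Since i - 1 < h < j + 1, the two ends of a chord lie in different halves and cannot be
    exchanged, so a chord determines its pair of indices. *)
Lemma uniq_chords A A' : uniq A -> uniq A' ->
  (forall i, i \in A -> 0 < i < h) -> (forall j, j \in A' -> h <= j < n.-1) ->
  uniq (chords A A').
Proof.
move=> uA uA' AP A'P; apply: allpairs_uniq => // -[? ?] [? ?].
move=> /allpairsP[[i j] [/= /AP iP /A'P jP [-> ->]]].
move=> /allpairsP[[i' j'] [/= /AP i'P /A'P j'P [-> ->]]] /= eq_e.
have := set21 (s i.-1) (s j.+1); rewrite eq_e !inE => /orP[] /eqP.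
  move/vertex_inj => ii; have ii' := ii ltac:(lia) ltac:(lia).
  move: eq_e; rewrite ii' => /set2_inj/vertex_inj jj.
  have := jj ltac:(lia) ltac:(lia).
  by move=> [->]; congr (_, _); lia.
by move/vertex_inj => ij; have := ij ltac:(lia) ltac:(lia); lia.
Qed.


Lemma uniq_map_vertex (f : nat -> nat) (t : seq nat) : uniq t ->
  (forall i, i \in t -> f i < n) -> {in t &, injective f} ->
  uniq (map (fun i => s (f i)) t).
Proof.
move=> ut tn finj; rewrite map_inj_in_uniq // => i j it jt.
by move/vertex_inj => ij; apply: finj => //; apply: ij; apply: tn.
Qed.

(** The hypotheses on the starting position already allow for the b(2k+1) edges that Breaker can
    claim in 2k + 1 rounds. *)
Lemma extension_bounds B' : #|B' :\: B| <= b * (2 * k).+1 ->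
  [/\ degree B' p <= d, degree B' q <= d & #|B'| <= 2 * b * n].
Proof.
move=> B'B; have deg v := leq_trans (degreeD B B' v) (leq_add (leqnn _)
  (leq_trans (degree_card _ v) B'B)).
split; [exact: leq_trans dp | exact: leq_trans dq |].
apply: leq_trans B_card; apply: leq_trans (leq_add (leqnn #|B|) B'B).
apply: leq_trans (leq_card_setU _ _); apply: subset_leq_card.
by apply/subsetP=> e; rewrite !inE => ->; rewrite andbT orbN.
Qed.

(** Markov's inequality: the degrees sum to at most 4bn, so at most n/10 vertices exceed 40b. *)
Lemma count_busy B' : B' \subset board -> #|B'| <= 2 * b * n ->
  count (fun i => 40 * b < degree B' (s i.-1)) (iota 1 h.-1) * 10 <= n.
Proof.
move=> B'b B'n; have := card_degree_gt (40 * b) B'b.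
set D := [set v | _].
have : count (fun i => 40 * b < degree B' (s i.-1)) (iota 1 h.-1) <= #|D|.
  rewrite -size_filter -(size_map (fun i => s i.-1)) cardE.
  apply: uniq_leq_size; last first.
    move=> x /mapP[i]; rewrite mem_filter => /andP[iD _] ->.
    by rewrite mem_enum inE.
  apply: (subseq_uniq (map_subseq _ (filter_subseq _ _))).
  apply: uniq_map_vertex; first exact: iota_uniq.
    by move=> i; rewrite mem_iota_head; apply: head_pred_lt.
  by move=> i j; rewrite !mem_iota_head; case: i j => [|i] [|j] //= _ _ ->.
move=> cD Db; have b4 : 0 < 4 * b by lia.
rewrite -(leq_pmul2l b4).
apply: leq_trans (_ : #|D| * (40 * b) <= _); last by lia.
set x := count _ _ in cD *.
have -> : 4 * b * (x * 10) = x * (40 * b) by ring.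
by rewrite leq_mul2r cD orbT.
Qed.

Lemma rotating_anti a a' M' B' B'' : B' \subset B'' ->
  rotating a a' M' B'' -> rotating a a' M' B'.
Proof.
move=> sub [A [A' [[H1 H2 H3] [H4 H5 H6 H7] [H8 H9 H10 H11]]]].
exists A, A'; split; split=> //.
- exact: subset_trans H2.
- by apply: leq_trans H3; apply: subset_leq_card; apply: setSD.
- by apply: leq_trans H7; apply: leq_sum => i _; apply: degreeS.
- by apply: leq_trans H11; apply: sub_count => e; apply: (subsetP sub).
Qed.

Lemma card_extension a B' S : #|S| <= b -> #|B' :\: B| <= b * a ->
  #|(B' :|: S) :\: B| <= b * a.+1.
Proof.
move=> Sb B'B; rewrite mulnS addnC; apply: leq_trans (leq_add B'B Sb).
apply: leq_trans (leq_card_setU _ _); apply: subset_leq_card.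
by apply/subsetP=> e; rewrite !inE; case: (e \in B); case: (e \in B').
Qed.

(** The predecessors s_(i-1) are distinct, so the handshake lemma bounds their degrees in [S] by 2b
    altogether. *)
Lemma sum_degree_ext A B' S : uniq A -> (forall i, i \in A -> 0 < i < h) ->
  S \subset board -> #|S| <= b ->
  \sum_(i <- A) degree (B' :|: S) (s i.-1) <=
    \sum_(i <- A) degree B' (s i.-1) + 2 * b.
Proof.
move=> uA AP Sb S_b.
apply: leq_trans
  (_ : \sum_(i <- A) (degree B' (s i.-1) + degree S (s i.-1)) <= _).
  by apply: leq_sum => i _; apply: degreeU.
rewrite big_split /= leq_add2l -(big_map (fun i => s i.-1) predT (degree S)).
apply: leq_trans (sum_degree_seq _ Sb) _; last by rewrite mulnC leq_mul2l.
apply: uniq_map_vertex => // [i /AP|i j /AP iP /AP jP]; lia.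
Qed.

Lemma rotate_head a M' B' : a < k -> rotating a 0 M' B' ->
  force board b (rotating a.+1 0) 1 M' B'.
Proof.
move=> ak [A [A' [[MM' B'b B'B] [uA sA AP A_deg] [uA' sA' A'P A'_conf]]]].
apply: force1 => [M1 B1 B2|S S1 Sb]; first exact: rotating_anti.
have Sboard : S \subset board by apply: subset_trans S1 (subsetDl _ _).
have BSboard : B' :|: S \subset board by rewrite subUset B'b.
have BSB : #|(B' :|: S) :\: B| <= b * (a.+1 + 0).
  by rewrite addn0; apply: card_extension; rewrite addn0 in B'B.
have [_ dqS BSn] : [/\ degree (B' :|: S) p <= d, degree (B' :|: S) q <= d
    & #|B' :|: S| <= 2 * b * n].
  apply: extension_bounds; apply: leq_trans BSB _.
  by rewrite leq_mul2l; apply/orP; right; clear - ak; lia.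
have busy := count_busy BSboard BSn.
have AP' i : i \in A -> 0 < i < h by case/AP/andP.
have [|i [iP iA iq ideg]] := @pigeonhole3 _ (mem A)
  (fun i => [set q; s i] \in B' :|: S)
  (fun i => 40 * b < degree (B' :|: S) (s i.-1)) (iota 1 h.-1).
  have cA := count_mem_size A (iota_uniq 1 h.-1).
  have cq : count (fun i => [set q; s i] \in B' :|: S) (iota 1 h.-1) <= d.
    apply: leq_trans dqS; apply: count_degree.
    apply: (@uniq_map_vertex id); first exact: iota_uniq.
      by move=> j; rewrite mem_iota_head; apply: head_lt.
    by move=> j j' _ _.
  rewrite size_iota; rewrite sA in cA; exact: head_room n_large ak cA cq busy.
rewrite mem_iota_head in iP; exists [set q; s i]; split=> //.
  rewrite set2_board -nth0 nth_uniq ?(head_lt iP) //.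
    by case/andP: iP; case: (i).
  exact: leq_ltn_trans (head_lt iP).
exists (i :: A), [::]; split; split=> //=.
- by apply: subset_trans MM' (subsetUr _ _).
- by rewrite iA.
- by rewrite sA.
- move=> j; rewrite inE => /orP[/eqP ->|/AP/andP[-> jM]]; last first.
    by rewrite in_setU jM orbT.
  by rewrite setU11 andbT.
- rewrite big_cons; have := sum_degree_ext B' uA AP' Sboard Sb.
  by rewrite -leqNgt in ideg; move/head_degree/(_ A_deg ideg).
- have -> : chords (i :: A) [::] = [::] by rewrite /chords; elim: (i :: A).
  by rewrite muln0.
Qed.

Lemma rotate_tail a' M' B' : a' < k -> rotating k a' M' B' ->
  force board b (rotating k a'.+1) 1 M' B'.
Proof.
move=> ak [A [A' [[MM' B'b B'B] [uA sA AP A_deg] [uA' sA' A'P A'_conf]]]].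
apply: force1 => [M1 B1 B2|S S1 Sb]; first exact: rotating_anti.
have Sboard : S \subset board by apply: subset_trans S1 (subsetDl _ _).
have BSboard : B' :|: S \subset board by rewrite subUset B'b.
have BSB : #|(B' :|: S) :\: B| <= b * (k + a'.+1).
  by rewrite addnS; apply: card_extension.
have [dpS _ BSn] : [/\ degree (B' :|: S) p <= d, degree (B' :|: S) q <= d
    & #|B' :|: S| <= 2 * b * n].
  apply: extension_bounds; apply: leq_trans BSB _.
  by rewrite leq_mul2l; apply/orP; right; clear - ak; lia.
have AP' i : i \in A -> 0 < i < h by case/AP/andP.
have A'P' j : j \in A' -> h <= j < n.-1 by case/A'P/andP.
have A_deg' := sum_degree_ext B' uA AP' Sboard Sb.
have A_degS : \sum_(i <- A) degree (B' :|: S) (s i.-1) <=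
    42 * b * k + 2 * b * a'.+1.
  by apply: leq_trans A_deg' _; rewrite mulnS [2 * b + _]addnC addnA leq_add2r.
set range := iota h (n.-1 - h).
(* Excluded are the used positions, those with p s_j owned by Breaker, and those lying on a chord of
   Breaker; the last are at most as many as the degree sum of the vertices s_(i-1), which is at most
   44bk. *)
have [|j [jP jA' jp jconf]] := @pigeonhole3 _ (mem A')
  (fun j => [set p; s j] \in B' :|: S)
  (fun j => has (fun i => [set s i.-1; s j.+1] \in B' :|: S) A) range.
  have cA' := count_mem_size A' (iota_uniq h (n.-1 - h)).
  have cp : count (fun i => [set p; s i] \in B' :|: S) range <= d.
    apply: leq_trans dpS; apply: count_degree.
    apply: (@uniq_map_vertex id); first exact: iota_uniq.
      by move=> j; rewrite mem_iota_tail; apply: tail_lt.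
    by move=> j j' _ _.
  have cc : count (fun j => has (fun i => [set s i.-1; s j.+1] \in B' :|: S) A)
      range <= 44 * b * k.
    apply: leq_trans (count_has _ _ _) _.
    apply: leq_trans (_ : \sum_(i <- A) degree (B' :|: S) (s i.-1) <= _).
      apply: leq_sum => i _; apply: (count_degree _ _ (f := fun j => s j.+1)).
      apply: (@uniq_map_vertex succn); first exact: iota_uniq.
        by move=> j; rewrite mem_iota_tail; apply: tail_succ_lt.
      by move=> j j' _ _ [].
    exact: leq_trans A_degS (tail_degree b ak).
  rewrite size_iota; rewrite sA' in cA'; exact: tail_room n_large ak cA' cp cc.
rewrite mem_iota_tail in jP; exists [set p; s j]; split=> //.
  rewrite set2_board -nth_last nth_uniq ?(tail_lt jP) //.
    by rewrite gtn_eqF //; case/andP: jP.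
  by rewrite ltn_predL; apply: leq_ltn_trans (tail_lt jP).
exists A, (j :: A'); split; split=> //=.
- by apply: subset_trans MM' (subsetUr _ _).
- by move=> i /AP/andP[-> iM]; rewrite in_setU iM orbT.
- by rewrite jA'.
- by rewrite sA'.
- move=> i; rewrite inE => /orP[/eqP ->|/A'P/andP[-> iM]]; last first.
    by rewrite in_setU iM orbT.
  by rewrite setU11 andbT.
- have /permP -> : perm_eq (chords A (j :: A'))
      ([seq [set s i.-1; s j.+1] | i <- A] ++ chords A A').
    apply/permPl.
  exact: (perm_allpairs_consr _ A (fun=> j) (fun=> A')).
  (* By the choice of [j] none of the new chords is Breaker's, so the count grows only by old chords
     in [S], at most [b] of them. *)
  rewrite count_cat count_map; have /eqP -> :
      count (preim (fun i => [set s i.-1; s j.+1]) (mem (B' :|: S))) A == 0.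
    by rewrite eqn0Ngt -has_count.
  have uC := uniq_chords uA uA' AP' A'P'.
  apply: leq_trans
    (_ : count (mem B') (chords A A') + count (mem S) (chords A A') <= _).
    rewrite add0n -count_predUI -[leqLHS]addn0 leq_add //.
    by apply: sub_count => e /=; rewrite in_setU.
  rewrite mulnS addnC leq_add // (leq_trans _ Sb) //.
  rewrite -size_filter cardE; apply: uniq_leq_size; first exact: filter_uniq.
  by move=> e; rewrite mem_filter mem_enum => /andP[].
Qed.

Lemma rotating_init : rotating 0 0 M B.
Proof.
exists [::], [::]; split; split=> //=; first by rewrite setDv cards0.
by rewrite big_nil.
Qed.

Lemma force_rotating : force board b (rotating k k) (k + k) M B.
Proof.
have part1 a : a <= k -> force board b (rotating a 0) a M B.
  elim: a => [_|a IHa ak]; first exact: rotating_init.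
  rewrite -[X in force _ _ _ X]addn1.
  by apply: force_trans (IHa (ltnW ak)) _ => M' B'; apply: rotate_head.
have part2 a : a <= k -> force board b (rotating k a) (k + a) M B.
  elim: a => [_|a IHa ak]; first by rewrite addn0; apply: part1.
  rewrite addnS -[X in force _ _ _ X]addn1.
  by apply: force_trans (IHa (ltnW ak)) _ => M' B'; apply: rotate_tail.
exact: part2.
Qed.

(** The k^2 chords are distinct. Breaker owns at most bk of them after the rotations and his next
    move takes at most [b] more, which does not exhaust them. *)
Lemma free_chord M' B' S : b * k.+1 < k * k -> rotating k k M' B' ->
  S \subset board -> #|S| <= b ->
  exists i j, [/\ 0 < i < h, h <= j < n.-1, [set q; s i] \in M',
    [set p; s j] \in M' & [set s i.-1; s j.+1] \notin B' :|: S].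
Proof.
move=> bk [A [A' [_ [uA sA AP _] [uA' sA' A'P A'_conf]]]] Sboard Sb.
have [allBS|] := boolP (all (mem (B' :|: S)) (chords A A')); last first.
  move=> /allPn[_ /allpairsP[[i j] [/= iA jA' ->]] free].
  have /andP[iP iM] := AP i iA; have /andP[jP jM] := A'P j jA'.
  by exists i, j.
have uC : uniq (chords A A').
  by apply: uniq_chords => // [i /AP/andP[]|j /A'P/andP[]].
have : size (chords A A') <= b * k + b.
  apply: leq_trans
    (_ : count (mem B') (chords A A') + count (mem S) (chords A A') <= _).
    rewrite -count_predUI -[leqLHS]addn0 leq_add //.
    move: allBS; rewrite all_count => /eqP <-.
    by apply: sub_count => e /=; rewrite in_setU.
  rewrite leq_add // (leq_trans _ Sb) //.
  rewrite -size_filter cardE; apply: uniq_leq_size; first exact: filter_uniq.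
  by move=> e; rewrite mem_filter mem_enum => /andP[].
by rewrite size_allpairs sA sA' addnC -mulnS leqNgt bk.
Qed.

End Phase2.

Lemma split3 (T : eqType) (v0 : T) (c : seq T) i j :
  0 < i -> i <= j -> j.+1 < size c ->
  exists s1 s2 s3, [/\ c = s1 ++ s2 ++ s3, s1 != [::], s2 != [::], s3 != [::] &
    [/\ head v0 s2 = nth v0 c i, last v0 s2 = nth v0 c j,
        last v0 s1 = nth v0 c i.-1 & head v0 s3 = nth v0 c j.+1]].
Proof.
move=> i0 ij jn; exists (take i c), (take (j.+1 - i) (drop i c)), (drop j.+1 c).
have size2 : size (take (j.+1 - i) (drop i c)) = (j.+1 - i).
  by rewrite size_take_min size_drop; lia.
split.
- rewrite -[c in LHS](cat_take_drop i); congr (_ ++ _).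
  rewrite -[LHS](cat_take_drop (j.+1 - i)) drop_drop.
  by congr (_ ++ drop _ _); lia.
- by rewrite -size_eq0 size_take_min; lia.
- by rewrite -size_eq0 size2; lia.
- by rewrite -size_eq0 size_drop; lia.
split.
- by rewrite -nth0 nth_take ?nth_drop ?addn0 //; lia.
- by rewrite -nth_last size2 nth_take ?nth_drop; [congr nth; lia | lia].
- rewrite -nth_last size_take_min (minn_idPl _) ?nth_take //; lia.
- by rewrite -nth0 nth_drop addn0.
Qed.

Lemma chords_exceed b : b * b.+3 < b.+2 * b.+2.
Proof. lia. Qed.

(** * Closing the rotated tour by a chord *)

Section Closing.
Context (R : realFieldType) {V : finType}.
Implicit Types (M B S : {set {set V}}) (v x y : V) (c : seq V) (m : nat).
Local Open Scope ring_scope.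
Local Notation board := (complete_edges V).

Lemma chord_arith (a a' b b' c c' x y z : R) :
  a' <= a -> b' <= b -> c' <= c -> 0 <= x -> 0 <= y ->
  a' + 0 + (b' + 0 + c') + 0 <= a + x + (b + y + c) + z - z.
Proof. lra. Qed.

(** Reversing the outer arcs creates exactly three new junctions: the two edges claimed at the ends
    of the gap and the chord. All three contribute zero, while the gap at the old seam is lost. *)
Lemma csum_chords (f f' : V -> V -> R) v0 s1 s2 s3 :
  (forall x y, f' x y = f' y x) ->
  (forall x y, f' x y <= f x y) -> (forall x y, 0 <= f x y) ->
  s1 != [::] -> s2 != [::] -> s3 != [::] ->
  f' (head v0 s1) (head v0 s2) = 0 -> f' (last v0 s2) (last v0 s3) = 0 ->
  f' (head v0 s3) (last v0 s1) = 0 ->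
  csum f' (rev s1 ++ s2 ++ rev s3) <=
    csum f (s1 ++ s2 ++ s3) - f (last v0 s3) (head v0 s1).
Proof.
move=> fC f'f f0 n1 n2 n3 z1 z2 z3.
have rn1 : rev s1 != [::] by rewrite -size_eq0 size_rev size_eq0.
have rn3 : rev s3 != [::] by rewrite -size_eq0 size_rev size_eq0.
have cat_n0 (s t : seq V) : s != [::] -> s ++ t != [::] by case: s.
have hd (s t : seq V) : s != [::] -> head v0 (s ++ t) = head v0 s by case: s.
have lst (s t : seq V) : t != [::] -> last v0 (s ++ t) = last v0 t.
  by rewrite last_cat; case: t.
rewrite !(csum_cat v0) ?cat_n0 // !(psum_cat v0) // !psum_rev // !hd // !lst //.
rewrite !last_rev !head_rev z1 z2 z3.
by apply: chord_arith => //; apply: le_psum.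
Qed.

Lemma phase2_step b L g N M B
    (k := b.+2) (K := (2 * k).+1) (m := (8 * (b * K))%N) :
  (0 < b)%N -> (#|V| < 2 ^ L)%N -> (N + b * K <= 2 * b * #|V|)%N ->
  (10 * (k + (m * L.+1 + b * K) + 44 * b * k + 5) <= 3 * #|V|)%N ->
  state R m g.+1 N M B -> force board b (state R m g (N + b * K)) K M B.
Proof.
move=> b0 VL NK n_large [c [c_perm c_gaps c_pot Bb BN]].
have m0 : (0 < m)%N by rewrite !muln_gt0 b0.
have [few|many] := leP (csum (is_gap R M) c) g%:R.
  by apply: force_now; exists c; split=> //; apply: leq_trans (leq_addr _ _).
have [v0 _] : exists v0 : V, v0 \in c.
  move: many; case: (c) => [|v s _]; last by exists v; rewrite mem_head.
  by rewrite /csum big_nil ltNge ler0n.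
have gap0 : 0 < csum (is_gap R M) c by apply: le_lt_trans many.
have [c' [c'_perm c'_sum gap_pq growth]] :=
  gap_rotation B v0 m0 (perm_enum_uniq c_perm) gap0.
rewrite -(c'_sum _ (is_gapC R M)) in c_gaps.
rewrite /potential -(c'_sum _ (gap_weightC R m M B)) in c_pot.
rewrite -/(potential _ _ _ _ _) in c_pot.
have {}c'_perm := perm_trans c'_perm c_perm.
have uc' := perm_enum_uniq c'_perm.
have size_c' : size c' = #|V| by rewrite (perm_size c'_perm) -cardE.
have cn0 : c' != [::].
  by apply: contraTneq n_large; rewrite -size_c' => ->; rewrite muln0.
have pq_c' : (last v0 c', head v0 c') \in cpairs c'.
  by rewrite (cpairs_rcons v0 cn0) mem_rcons mem_head.
have [dp dq] := degree_bound m0 VL c_pot pq_c' gap_pq.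
have {}dp : (degree B (last v0 c') + b * (2 * k).+1 <= m * L.+1 + b * K)%N.
  by rewrite leq_add2r ltnW.
have {}dq : (degree B (head v0 c') + b * (2 * k).+1 <= m * L.+1 + b * K)%N.
  by rewrite leq_add2r ltnW.
have B_card : (#|B| + b * (2 * k).+1 <= 2 * b * size c')%N.
  by rewrite size_c'; apply: leq_trans NK; rewrite leq_add2r.
rewrite -size_c' in n_large.
have rotated := force_rotating M uc' b0 Bb dp dq B_card n_large.
(* k rounds at each end of the gap, then one round for the chord. *)
rewrite [X in force _ _ _ X](_ : K = (k + k + 1)%N); last first.
  by rewrite /K mul2n -addnn addn1.
apply: force_trans rotated _ => M' B' rot_kk.
apply: force1 => [M1 B1 B2|S S1 Sb]; first exact: state_anti.
have SV : S \subset board by apply: subset_trans S1 (subsetDl _ _).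
have bk : (b * k.+1 < k * k)%N := chords_exceed b.
have [i [j [iP jP iM jM free_e]]] := 
  free_chord uc' b0 Bb dp dq B_card n_large bk rot_kk SV Sb.
have [A [A' [[MM' B'b B'B] _ _]]] := rot_kk.
exists [set nth v0 c' i.-1; nth v0 c' j.+1]; split=> //.
  rewrite set2_board nth_uniq ?(head_pred_lt iP) ?(tail_succ_lt jP) //.
  by clear - iP jP; lia.
have [|||s1 [s2 [s3 [c'E n1 n2 n3 [e1 e2 e3 e4]]]]] := @split3 _ v0 c' i j.
- by case/andP: iP.
- by case/andP: iP => _ /ltnW/leq_trans; apply; case/andP: jP.
- exact: tail_succ_lt jP.
set e := [set _; nth v0 c' j.+1]; set M'' := e |: M'; set B'' := B' :|: S.
have MM'' : M \subset M'' by apply: subset_trans MM' (subsetUr _ _).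
have qE : head v0 c' = head v0 s1 by rewrite c'E; case: (s1) n1.
have pE : last v0 c' = last v0 s3 by rewrite c'E !last_cat; case: (s3) n3.
(* [rotating] does not record that [B'] contains [B]. Adding [B] makes degrees comparable with those
   at the start, and [state] is antitone in Breaker's graph. *)
apply: (@state_anti R V m g _ _ _ (B'' :|: B)); first exact: subsetUl.
have z1 : [set head v0 s1; head v0 s2] \in M''.
  by rewrite e1 -qE in_setU iM orbT.
have z2 : [set last v0 s2; last v0 s3] \in M''.
  by rewrite e2 -pE setUC in_setU jM orbT.
have z3 : [set head v0 s3; last v0 s1] \in M'' by rewrite e3 e4 setUC setU11.
have gapz x y : [set x; y] \in M'' -> is_gap R M'' x y = 0.
  by rewrite /is_gap => ->.
have weightz B1 x y : [set x; y] \in M'' -> gap_weight R m M'' B1 x y = 0.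
  by move/gapz => z; rewrite /gap_weight z mul0r.
rewrite pE qE in gap_pq.
have B''B : (#|(B'' :|: B) :\: B| <= b * K)%N.
  apply: leq_trans (_ : #|B'' :\: B| <= _)%N.
    apply: subset_leq_card; apply/subsetP=> u.
    by rewrite !inE; case: (u \in B); rewrite ?orbF.
  by rewrite /K mul2n -addnn; apply: card_extension.
exists (rev s1 ++ s2 ++ rev s3); split.
- apply: perm_trans c'_perm; rewrite c'E.
  by apply: perm_cat; rewrite ?perm_cat2l perm_rev.
- apply: le_trans (csum_chords (v0 := v0) _ _ _ n1 n2 n3 _ _ _) _;
    try exact: gapz.
  + exact: is_gapC.
  + by move=> x y; apply: (is_gapS R _ _ MM'').
  + exact: is_gap_ge0.
  rewrite -c'E /is_gap gap_pq lerBlDr natr1 //.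
- apply: le_trans (csum_chords (v0 := v0) _ _ _ n1 n2 n3 _ _ _) _;
    try exact: weightz.
  + exact: gap_weightC.
  + by move=> x y; apply: (gap_weightS R m _ _ MM'' (subxx (B'' :|: B))).
  + exact: gap_weight_ge0.
  have bK8 : (b * K * 8 <= m)%N by rewrite mulnC.
  have BBb : B'' :|: B \subset board by rewrite !subUset B'b SV.
  (* The growth over all [K] rounds is at most the weight that p had in [B], and the removed gap
     weighs at least as much. *)
  have := growth _ _ BBb B''B bK8; rewrite -c'E {1}/potential => growth'.
  rewrite lerBlDr; apply: le_trans growth' _; apply: lerD => //.
  rewrite /gap_weight /is_gap gap_pq mul1r pE.
  apply: le_trans (_ : base R m ^+ degree (B'' :|: B) (last v0 s3) <= _).
    by apply: base_pow_mono; apply: degreeS; apply: subsetUr.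
  by rewrite lerDl exprn_ge0 // ltW // base_gt0.
- by rewrite !subUset B'b SV.
- apply: leq_trans (_ : #|B| + #|(B'' :|: B) :\: B| <= _)%N;
    last exact: leq_add.
  apply: leq_trans (leq_card_setU _ _); apply: subset_leq_card.
  by apply/subsetP=> u uB; rewrite !inE in uB *; rewrite uB andbT orbN.
Qed.

End Closing.

(** * The Hamilton cycle game *)

Lemma cycle_cpairs (T : eqType) (e : rel T) (c : seq T) :
  (forall x y, (x, y) \in cpairs c -> e x y) -> cycle e c.
Proof.
case: c => // x s; rewrite /cpairs rot1_cons [cycle _ _]/=.
elim: s {1 3}x => [|y s IHs] z /= eP; first by rewrite eP ?mem_head.
rewrite eP ?mem_head //=; apply: IHs => u v uv; apply: eP.
by rewrite in_cons uv orbT.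
Qed.

Section Combine.
Context (R : realFieldType) {V : finType}.
Implicit Types (M B S : {set {set V}}).
Local Open Scope ring_scope.
Local Notation board := (complete_edges V).

Lemma state_init m : state R m #|V| 0 (set0 : {set {set V}}) set0.
Proof.
exists (enum V); split;
  [exact: perm_refl | | | exact: sub0set | by rewrite cards0].
  rewrite csum_gapE ler_nat (leq_trans (count_size _ _)) //.
  by rewrite size_zip size_rot minnn -cardE.
apply: le_trans (_ : csum (fun x y : V => 1 + 1 : R) (enum V) <= _).
  apply: le_csum => x y _; rewrite /gap_weight /is_gap.
  have deg0 v : degree (set0 : {set {set V}}) v = 0%N.
    by apply/eqP; rewrite -leqn0 -(cards0 {set V}) degree_card.
  by rewrite in_set0 !deg0 mul1r.
rewrite (csumD (fun=> 1)) big_const_seq count_predT -cardE.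
by rewrite iter_addr_0 -mulrnA.
Qed.

Lemma state_hamilton m N M B : (2 < #|V|)%N -> state R m 0 N M B ->
  has_hamilton_cycle M.
Proof.
move=> V2 [c [c_perm c_gaps _ _ _]]; exists c; split.
- by rewrite (perm_size c_perm) -cardE.
- rewrite /ucycle (perm_enum_uniq c_perm) andbT; apply: cycle_cpairs => x y xyc.
  move: c_gaps; rewrite csum_gapE ler_nat leqn0 => /eqP/eqP.
  rewrite eqn0Ngt -has_count => /hasPn/(_ _ xyc) /=.
  by rewrite negbK.
- by move=> v; rewrite (perm_mem c_perm) mem_enum.
Qed.

(** Links the two phases: the larger [m] of the second phase means a smaller base, hence a smaller
    potential. *)
Lemma state_bias m m' g N M B : (0 < m)%N -> (m <= m')%N ->
  state R m g N M B -> state R m' g N M B.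
Proof.
move=> m0 mm' [c [c1 c2 c3 c4 c5]]; exists c; split=> //.
by apply: le_trans c3; apply: le_csum => x y _; apply: gap_weight_anti.
Qed.

Lemma phase1 b L t : (0 < b)%N -> (#|V| < 2 ^ L)%N ->
  (8 * b * L.+2 + t <= #|V|)%N ->
  force board b (state R (8 * b) (#|V| - t) (b * t)) t set0 set0.
Proof.
move=> b0 VL; elim: t => [_|t IHt tV].
  by rewrite subn0 muln0; apply: state_init.
rewrite -[X in force _ _ _ X]addn1.
apply: force_trans (IHt (leq_trans _ tV)) _ => [|M B st].
  by rewrite leq_add2l.
rewrite mulnS addnC; apply: phase1_step (VL) _ _ => //.
  by rewrite leq_subRL; [rewrite addnC | apply: leq_trans tV; apply: leq_addl].
by rewrite -subSn ?subSS //; apply: leq_trans tV; apply: leq_addl.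
Qed.

Lemma phase2 b L r N M B (k := b.+2) (K := (2 * k).+1) (m := (8 * (b * K))%N) :
  (0 < b)%N -> (#|V| < 2 ^ L)%N -> (N + b * K * r <= 2 * b * #|V|)%N ->
  (10 * (k + (m * L.+1 + b * K) + 44 * b * k + 5) <= 3 * #|V|)%N ->
  state R m r N M B ->
  force board b (state R m 0 (N + b * K * r)) (r * K) M B.
Proof.
move=> b0 VL NK n_large; elim: r N M B NK => [|r IHr] N M B NK st.
  by rewrite muln0 addn0.
rewrite mulSn.
have NK' : (N + b * K + b * K * r <= 2 * b * #|V|)%N by rewrite -addnA -mulnS.
have step := phase2_step b0 VL (leq_trans (leq_addr _ _) NK') n_large st.
apply: force_trans step _ => M' B' st'.
by rewrite mulnS addnA; apply: IHr.
Qed.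

End Combine.

(** The last 8b(L+2) gaps cost K = 2b + 5 rounds each. Since b <= b^2, the product (16b^2 +
    40b)(L+2) is at most 56x. *)
Lemma parameters b L n (x := b * b * L.+2) (k := b.+2) (K := (2 * k).+1) :
  0 < b -> 56 * (100 * x) <= n ->
  [/\ 8 * b * L.+2 * K <= 56 * x, 8 * b * L.+2 <= n, 8 * b * L.+2 * K <= n &
      10 * (k + (8 * (b * K) * L.+1 + b * K) + 44 * b * k + 5) <= 3 * n].
Proof.
move=> b0; have -> : K = 2 * b + 5 by rewrite /K /k; lia.
rewrite /k => xn.
have bb : b <= b * b by rewrite leq_pmulr.
have bx : b * b * 2 <= x by rewrite /x leq_mul2l orbT.
have xE : x = b * b * L + b * b * 2 by rewrite /x; ring.
have bL : b * L <= b * b * L by rewrite leq_mul2r bb orbT.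
have e1 : 8 * b * L.+2 * (2 * b + 5) =
    16 * (b * b * L) + 32 * (b * b) + 40 * (b * L) + 80 * b by ring.
have e2 : 8 * b * L.+2 = 8 * (b * L) + 16 * b by ring.
have e3 : 8 * (b * (2 * b + 5)) * L.+1 + b * (2 * b + 5) =
   16 * (b * b * L) + 40 * (b * L) + 18 * (b * b) + 45 * b by ring.
have e4 : 44 * b * b.+2 = 44 * (b * b) + 88 * b by ring.
rewrite e1 e2 e3 e4; move: xE xn bx bb bL b0; rewrite {e1 e2 e3 e4}.
(* With the monomials generalized to variables, all four goals are linear. *)
move: x (b * b * L) (b * L) (b * b) => {}x u v w.
by move=> *; split; lia.
Qed.

Lemma maker_wins_hamilton n b L : 0 < b -> 2 < n -> n < 2 ^ L ->
  56 * (100 * (b * b * L.+2)) <= n ->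
  maker_wins_hamilton_within n b (n + 56 * (b * b * L.+2)).
Proof.
move=> b0 n2 nL xn; have [rK rn rKn n_large] := parameters b0 xn.
set r := 8 * b * L.+2 in rK rn rKn; set K := (2 * b.+2).+1 in rK rKn.
have cV : #|'I_n| = n by apply: card_ord.
(* An arbitrary inhabitant, serving as the default answer. *)
apply: (@force_maker_wins _ _ _ _ _ [set Ordinal (ltnW (ltnW n2))]).
(* The first phase takes n - r rounds and leaves r gaps of cost [K] each. *)
apply: (@force_leq _ _ _ _ ((n - r) + r * K)).
  by apply: leq_add rK; apply: leq_subr.
have part1 : force (complete_edges 'I_n) b (state rat (8 * b) r (b * (n - r)))
    (n - r) set0 set0.
  have := @phase1 rat 'I_n b L (n - r) b0.
  by rewrite cV subKn //; apply=> //; rewrite subnKC.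
apply: force_trans part1 _ => M B st.
have st2 : state rat (8 * (b * K)) r (b * (n - r)) M B.
  apply: state_bias st; first by rewrite muln_gt0.
  by rewrite leq_pmul2l // (leq_pmulr b (ltn0Sn _)).
have NK : b * (n - r) + b * K * r <= 2 * b * #|'I_n|.
  rewrite cV [2 * b]mulnC -mulnA -mulnA -mulnDr leq_mul2l mul2n -addnn.
  by rewrite leq_add ?orbT ?leq_subr // mulnC.
have VL : #|'I_n| < 2 ^ L by rewrite cV.
apply: force_impl (phase2 b0 VL NK _ st2); last by rewrite cV.
by move=> M' B'; apply: state_hamilton; rewrite cV.
Qed.

Local Open Scope ring_scope.

Theorem theorem1p3 (R : realType) :
  exists delta C : R, [/\ 0 < delta, 0 < C &
    exists n0 : nat, forall n : nat, (n0 <= n)%N ->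
      forall b : nat, (0 < b)%N ->
        b%:R <= delta * Num.sqrt (n%:R / ln n%:R ^+ 5) ->
        exists m : nat,
          m%:R <= n%:R + C * b%:R ^+ 2 * ln n%:R ^+ 5 /\
          maker_wins_hamilton_within n b m].
Proof.
(* Chosen so that L + 2 <= ln n / ln 2 + 3 <= c0 ln n once ln n >= 1. *)
pose c0 : R := (ln 2)^-1 + 3.
have ln2 : 0 < ln 2 :> R by rewrite ln_gt0 // ltr1n.
have c0_gt0 : 0 < c0 by rewrite addr_gt0 ?invr_gt0.
(* Squaring the bound on [b] then gives 5600 c0 b^2 ln^5 n <= n, which implies the size hypothesis
   of [maker_wins_hamilton]; its surplus 56 b^2 (L+2) dictates the second constant. *)
exists (Num.sqrt (56 * (100 * c0))^-1), (56 * c0); split.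
- by rewrite sqrtr_gt0 invr_gt0 !mulr_gt0.
- by rewrite mulr_gt0.
(* A cycle needs n >= 3, and n >= e ensures ln n >= 1. *)
exists (maxn 3 (Num.bound (expR 1 : R))) => n.
rewrite geq_max => /andP[n3 n_e] b b0 b_le.
have n0 : 0 < n%:R :> R by rewrite ltr0n; apply: leq_trans n3.
have ln1 : 1 <= ln n%:R :> R.
  rewrite -[leLHS]expRK ler_ln ?posrE ?expR_gt0 //.
  apply: ltW; apply: lt_le_trans (archi_boundP (expR_ge0 1)) _.
  by rewrite ler_nat.
pose t := trunc_log 2 n; pose L := t.+1.
have nL : (n < 2 ^ L)%N by apply: trunc_log_ltn.
have t_ln : t%:R * ln 2 <= ln n%:R :> R.
  have tn : (2 ^ t <= n)%N by apply: trunc_logP => //; apply: leq_trans n3.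
  by rewrite mulr_natl -lnXn // ler_ln ?posrE ?exprn_gt0 // -natrX ler_nat.
have L_ln : L.+2%:R <= c0 * ln n%:R :> R.
  have : t%:R <= (ln 2)^-1 * ln n%:R :> R by rewrite ler_pdivlMl // mulrC.
  rewrite /L -[t.+3]addn3 natrD /c0 mulrDl; move: ((ln 2)^-1 * _) => z.
  by move: ln1; move: (ln _) => y; lra.
have L_ln5 : L.+2%:R <= c0 * ln n%:R ^+ 5 :> R.
  by apply: le_trans L_ln _; rewrite ler_pM2l // ler_eXnr.
have x_le : (b * b * L.+2)%:R <= c0 * (b%:R ^+ 2 * ln n%:R ^+ 5) :> R.
  by rewrite !natrM -expr2 mulrCA ler_wpM2l // sqr_ge0.
have lnp : 0 < ln n%:R ^+ 5 :> R by rewrite exprn_gt0 // (lt_le_trans ltr01).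
exists (n + 56 * (b * b * L.+2))%N; split.
  rewrite natrD lerD2l natrM -(mulrA 56 c0) -[leRHS]mulrA -(mulrA c0).
  by rewrite ler_pM2l.
apply: maker_wins_hamilton => //.
rewrite -(ler_nat R) natrM (natrM _ 100).
have b2_le : b%:R ^+ 2 <= (56 * (100 * c0))^-1 * (n%:R / ln n%:R ^+ 5) :> R.
  have := b_le; rewrite -(@ler_sqr R) ?nnegrE ?mulr_ge0 ?sqrtr_ge0 //.
  rewrite exprMn !sqr_sqrtr //; first by rewrite divr_ge0 // ltW.
  by rewrite invr_ge0 !mulr_ge0 // ltW.
apply: le_trans (_ : 56 * (100 * (c0 * (b%:R ^+ 2 * ln n%:R ^+ 5))) <= _).
  by rewrite !ler_pM2l.
have -> : 56 * (100 * (c0 * (b%:R ^+ 2 * ln n%:R ^+ 5))) =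
    56 * (100 * c0) * (b%:R ^+ 2 * ln n%:R ^+ 5) :> R by rewrite !mulrA.
by rewrite -ler_pdivlMl ?mulr_gt0 // -ler_pdivlMr // -mulrA.
Qed.
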